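(* Let $a_2,a_3$ be integers with $1<a_2<a_3$, $A=\{1,a_2,a_3\}$, and let $h$ be a positive integer with $X(h)\ge a_3$. Then for every integer $x$ with $X(h)<x<ha_3$: $x$ has no $h$-representation if and only if $x+a_3$ has no $(h+1)$-representation.
   Context: An integer $x$ has an $h$-representation if $x=c_3a_3+c_2a_2+c_1$ with integers $c_1,c_2,c_3\ge0$ and $c_1+c_2+c_3\le h$. $X(h)$ is one less than the smallest positive integer with no $h$-representation. *)

(* Defs.v *)
From mathcomp Require Import all_boot.

Definition hrep (a2 a3 h x : nat) : Prop :=
  exists c1 c2 c3 : nat, x = c3 * a3 + c2 * a2 + c1 /\ c1 + c2 + c3 <= h.

Definition is_X (a2 a3 h m : nat) : Prop :=
  (forall y, 1 <= y <= m -> hrep a2 a3 h y) /\ ~ hrep a2 a3 h m.+1.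

(* Main.v *)
Require Import Defs.
From mathcomp Require Import all_boot.
From mathcomp Require Import zify.

Set Implicit Arguments.
Unset Strict Implicit.

(** Suppose [x + a3 = c2 * a2 + c1] with [c1 + c2 <= h + 1]; a representation
    using [a3] would give one of [x] at once. Write
    [x + a3 - i * a3 = u i * a2 + v i] with [v i < a2], and let
    [D i = i + u i + v i]. If [x] has no [h]-representation, then
    [D 0 <= h + 1 < D i] for [1 <= i <= N := (x + a3) / a3]. Translating index
    differences back to [0], this forces the [v i] to be distinct and [D] to be
    strictly increasing as a function of [v]. Hence each [i] in [[1, N - 1]]
    provides either a value [D i] in [[h + 2, D N - 1]] or a value [v i] in
    [[v N + 1, a2 - 1]], the latter never being [a3 mod a2]. But
    [X(h) >= a3] forces [h >= a2 + a3 / a2 - 2], which leaves fewer than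
    [N - 1] such values. *)

Definition quo (a2 a3 y i : nat) := (y - i * a3) %/ a2.
Definition rem (a2 a3 y i : nat) := (y - i * a3) %% a2.
Definition weight (a2 a3 y i : nat) := i + quo a2 a3 y i + rem a2 a3 y i.

Lemma quo_remE (a2 a3 y i : nat) : i * a3 <= y ->
  y = i * a3 + quo a2 a3 y i * a2 + rem a2 a3 y i.
Proof. by move=> iy; rewrite -addnA -divn_eq subnKC. Qed.

Lemma rem_lt (a2 a3 y i : nat) : 0 < a2 -> rem a2 a3 y i < a2.
Proof. exact: ltn_pmod. Qed.

(** As [a3 > a2] and the remainders differ by less than [a2], giving up [i - j] copies of [a3] adds
    at least [i - j] copies of [a2]. *)
Lemma quo_drop (a2 a3 y i j : nat) :
  a2 < a3 -> 0 < a2 -> j <= i -> i * a3 <= y ->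
  rem a2 a3 y i <= rem a2 a3 y j ->
  i + quo a2 a3 y i <= j + quo a2 a3 y j.
Proof.
move=> a23 a2_gt0 ji iy.
have jy : j * a3 <= y by apply: leq_trans iy; rewrite leq_mul2r ji orbT.
have := quo_remE a2 iy; have := quo_remE a2 jy.
have := @rem_lt a2 a3 y j a2_gt0.
move: (quo a2 a3 y i) (quo a2 a3 y j) (rem a2 a3 y i) (rem a2 a3 y j).
move=> ui uj vi vj vj_lt Ej Ei vij; rewrite leqNgt; apply/negP => lt.
have := leq_mul lt (leqnn a2); have := leq_mul ji (ltnW a23).
have : (i - j) * a2 <= (i - j) * a3 by rewrite leq_mul2l (ltnW a23) orbT.
rewrite !mulnBl; nia.
Qed.

Lemma eq_of_diff_mod (a2 p q b c : nat) : b < a2 -> c < a2 ->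
  p * a2 + b = q * a2 + c -> p = q /\ b = c.
Proof.
move=> ba ca E; have a2_gt0 := leq_ltn_trans (leq0n b) ba.
have := congr1 (divn^~ a2) E; have := congr1 (modn^~ a2) E.
by rewrite !modnMDl !divnMDl // !modn_small // !divn_small // !addn0.
Qed.

Section Shift.

Context (a2 a3 y h : nat).
Hypotheses (a2_gt0 : 0 < a2) (a23 : a2 < a3).
Hypothesis weight0 : weight a2 a3 y 0 <= h.+1.
Hypothesis weight_gt :
  forall i, 0 < i -> i * a3 <= y -> h.+1 < weight a2 a3 y i.

Local Notation u := (quo a2 a3 y).
Local Notation v := (rem a2 a3 y).
Local Notation D := (weight a2 a3 y).

(** Otherwise [quo_drop] would give [D i <= D 0], although [D 0 <= h.+1 < D i]. *)
Lemma rem0_lt i : 0 < i -> i * a3 <= y -> v 0 < v i.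
Proof.
move=> i0 iy; rewrite ltnNge; apply/negP => le.
have := @quo_drop a2 a3 y i 0 a23 a2_gt0 (leq0n i) iy le.
have := weight_gt i0 iy; move: weight0; rewrite /weight; lia.
Qed.

(** Both sides equal [2 * y - j * a3]. *)
Lemma shift_to_0 i j : i < j -> j * a3 <= y ->
  u (j - i) * a2 + v (j - i) + (u i * a2 + v i)
  = u 0 * a2 + v 0 + (u j * a2 + v j).
Proof.
move=> ij jy.
have iy : i * a3 <= y by nia.
have dy : (j - i) * a3 <= y by nia.
have := quo_remE a2 iy; have := quo_remE a2 jy; have := quo_remE a2 dy.
have := @quo_remE a2 a3 y 0 (leq0n y); rewrite mulnBl.
have : i * a3 <= j * a3 by nia.
lia.
Qed.

Lemma rem_neq i j : i < j -> j * a3 <= y -> v i <> v j.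
Proof.
move=> ij jy E; have := shift_to_0 ij jy; rewrite E => S.
have dy : (j - i) * a3 <= y by nia.
have d0 : 0 < j - i by lia.
have := rem0_lt d0 dy.
have [|||_ ->] := @eq_of_diff_mod a2 (u (j - i) + u i) (u 0 + u j) (v (j - i)) (v 0);
  rewrite ?rem_lt ?ltnn //; lia.
Qed.

Lemma weight_mono i j : i * a3 <= y -> j * a3 <= y -> v i < v j -> D i < D j.
Proof.
move=> iy jy vij; case: (ltngtP i j) => [ij|ji|E]; last by move: vij; rewrite E ltnn.
- have dy : (j - i) * a3 <= y by nia.
  have d0 : 0 < j - i by lia.
  have S := shift_to_0 ij jy.
  have v0 := rem0_lt d0 dy; have w := weight_gt d0 dy.
  have l1 := @rem_lt a2 a3 y (j - i) a2_gt0.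
  have l2 := @rem_lt a2 a3 y j a2_gt0.
  (* Both differences lie strictly between [0] and [a2], so they agree. Then
     [D (j - i) + D i = D 0 + D j], and [D 0 < D (j - i)] decides. *)
  have [|||E1 E2] := @eq_of_diff_mod a2 (u (j - i) + u i) (u 0 + u j)
    (v (j - i) - v 0) (v j - v i); [lia | lia | lia |].
  move: w weight0; rewrite /weight; lia.
- have := @quo_drop a2 a3 y i j a23 a2_gt0 (ltnW ji) iy (ltnW vij).
  rewrite /weight; lia.
Qed.

(** Otherwise removing one more [a3] leaves a multiple of [a2], so that [v i.+1 = 0] is not above
    [v 0]. *)
Lemma rem_neq_mod i : i.+1 * a3 <= y -> v i <> a3 %% a2.
Proof.
move=> iy E.
have := rem0_lt (ltn0Sn i) iy; suff -> : v i.+1 = 0 by [].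
have iy' : i * a3 <= y by move: iy; rewrite mulSn; lia.
have := quo_remE a2 iy; have := quo_remE a2 iy'; have := divn_eq a3 a2.
have := @rem_lt a2 a3 y i.+1 a2_gt0; rewrite E mulSn => l1 e1 e2 e3.
have [|||_ //] := @eq_of_diff_mod a2 (a3 %/ a2 + u i.+1) (u i) (v i.+1) 0; lia.
Qed.

Lemma no_shift : a3 <= y -> a2 + a3 %/ a2 <= h + 2 -> False.
Proof.
move=> a3y hq.
have a3_gt0 : 0 < a3 by lia.
set N := y %/ a3.
have N_gt0 : 0 < N by rewrite divn_gt0.
have Ny : N * a3 <= y by rewrite leq_divM.
have inN i : i <= N -> i * a3 <= y.
  by move=> iN; apply: leq_trans Ny; rewrite leq_mul2r iN orbT.
have DN := weight_gt N_gt0 Ny.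
have vN := @rem_lt a2 a3 y N a2_gt0.
(* [f] codes the weights in [[h + 2, D N - 1]] by the numbers below [K], and the remainders above
   [v N] by the next [a2 - (v N).+1] numbers. *)
pose K := D N - h.+2.
pose f i := if v i < v N then D i - h.+2 else K + (v i - (v N).+1).
have f_in i : 0 < i < N ->
  if v i < v N then f i < K else (v N < v i) && (f i < K + (a2 - (v N).+1)).
  case/andP=> i0 iN; rewrite /f; case: (ltnP (v i) (v N)) => [lt|ge].
    have := weight_mono (inN _ (ltnW iN)) Ny lt.
    have := weight_gt i0 (inN _ (ltnW iN)); rewrite /K; lia.
  have := rem_neq iN Ny; have := @rem_lt a2 a3 y i a2_gt0; lia.
have Duniq i j : i < j -> 0 < i < N -> 0 < j < N -> f i <> f j.
  move=> ij iN jN; have vne := rem_neq ij (inN j ltac:(lia)).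
  have := f_in _ iN; have := f_in _ jN; rewrite /f.
  have wi := weight_gt (i := i) ltac:(lia) (inN i ltac:(lia)).
  have wj := weight_gt (i := j) ltac:(lia) (inN j ltac:(lia)).
  have mij := weight_mono (inN i ltac:(lia)) (inN j ltac:(lia)).
  have mji := weight_mono (inN j ltac:(lia)) (inN i ltac:(lia)).
  case: (ltnP (v i)) => ?; case: (ltnP (v j)) => ?; lia.
have us : uniq (map f (iota 1 N.-1)).
  rewrite map_inj_in_uniq ?iota_uniq // => i j; rewrite !mem_iota => iN jN E.
  case: (ltngtP i j) => // ij; first by case: (Duniq i j ij); lia.
  by case: (Duniq j i ij); lia.
have sub i : i \in map f (iota 1 N.-1) -> i \in iota 0 (K + (a2 - (v N).+1)).
  case/mapP=> k; rewrite !mem_iota => kN ->.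
  by have := f_in k ltac:(lia); case: ltnP; lia.
have := uniq_leq_size us sub; rewrite size_map !size_iota => size1.
have yE := quo_remE a2 Ny.
have yN : y < N.+1 * a3 by rewrite ltn_ceil.
have a3E := divn_eq a3 a2; have r_lt := ltn_pmod a3 a2_gt0.
(* The count [size1] amounts to [h + 2 <= a2 + u N]. With [hq] and [y - N * a3 < a3] this pins [u N]
   to [a3 %/ a2]. *)
have uq : a3 %/ a2 <= u N by move: size1 DN; rewrite /K /weight; lia.
have vr : v N < a3 %% a2.
  have : a3 %/ a2 * a2 <= u N * a2 by rewrite leq_mul2r uq orbT.
  by move: yN; rewrite mulSn; lia.
have uq' : u N <= a3 %/ a2.
  rewrite leqNgt; apply/negP => lt; have := leq_mul lt (leqnn a2).
  by move: yN; rewrite !mulSn; lia.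
(* The code of the remainder [a3 %% a2], which lies above [v N] but is missed by [f]; one more code
   breaks the tight count. *)
pose z := K + (a3 %% a2 - (v N).+1).
have us' : uniq (z :: map f (iota 1 N.-1)).
  rewrite /= us andbT; apply/mapP=> -[k]; rewrite mem_iota => kN.
  have := f_in k ltac:(lia); have := rem_neq_mod (i := k) (inN k.+1 ltac:(lia)).
  by rewrite /f /z; case: (ltnP (v k)); lia.
have sub' i : i \in z :: map f (iota 1 N.-1) -> i \in iota 0 (K + (a2 - (v N).+1)).
  by rewrite inE => /orP[/eqP->|/sub//]; rewrite mem_iota /z; lia.
have := uniq_leq_size us' sub'; rewrite /= size_map !size_iota.
by move: DN; rewrite /K /weight; lia.
Qed.

End Shift.

(** The number is below [a3], so [c3 = 0] and [c2 < a3 %/ a2]. The cheapest choice is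
    [c2 = a3 %/ a2 - 1], [c1 = a2 - 1]. *)
Lemma hrep_lower_bound (a2 a3 h : nat) : 1 < a2 -> a2 < a3 ->
  hrep a2 a3 h (a3 %/ a2 * a2).-1 -> a2 + a3 %/ a2 <= h + 2.
Proof.
move=> a2_gt1 a23 [c1 [c2 [c3 [E le]]]].
have q_gt0 : 0 < a3 %/ a2 by rewrite divn_gt0; lia.
have := leq_divM a3 a2; move: E q_gt0; set q := a3 %/ a2 => E q_gt0 qa.
have qa2 : a2 <= q * a2 by rewrite leq_pmull.
have c30 : c3 = 0 by case: c3 E le => // c3; rewrite mulSn; lia.
have c2q : c2 < q by rewrite ltnNge; apply/negP => /(leq_mul (leqnn a2)); lia.
have : (q - c2 - 1) * 1 <= (q - c2 - 1) * a2 by rewrite leq_mul2l; lia.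
have : (q - c2 - 1) * a2 + a2 + c2 * a2 = q * a2.
  by rewrite -mulSnr -mulnDl; congr (_ * _); lia.
by lia.
Qed.

Theorem theorem4 (a2 a3 h Xh : nat) :
  1 < a2 -> a2 < a3 -> 0 < h ->
  is_X a2 a3 h Xh -> a3 <= Xh ->
  forall x : nat, Xh < x -> x < h * a3 ->
    (~ hrep a2 a3 h x <-> ~ hrep a2 a3 h.+1 (x + a3)).
Proof.
move=> a2_gt1 a23 _ [Xrep _] a3X x _ _; have a2_gt0 := ltnW a2_gt1.
have hq : a2 + a3 %/ a2 <= h + 2.
  apply: hrep_lower_bound => //; apply: Xrep.
  have : a2 <= a3 %/ a2 * a2 by rewrite leq_pmull // divn_gt0 //; lia.
  by have := leq_divM a3 a2; lia.
split=> [nx [c1 [c2 [c3 [E le]]]] | nx [c1 [c2 [c3 [E le]]]]]; last first.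
  by apply: nx; exists c1, c2, c3.+1; rewrite mulSn; lia.
case: c3 => [|c3] in E le; last first.
  by apply: nx; exists c1, c2, c3; move: E; rewrite mulSn; lia.
apply: (@no_shift a2 a3 (x + a3) h) => //; last exact: leq_addl.
  (* Moving the multiples of [a2] inside [c1] over to [c2] does not raise the number of summands. *)
  rewrite /weight /quo /rem mul0n subn0 E mul0n !add0n.
  rewrite divnMDl // modnMDl; have := divn_eq c1 a2.
  have : c1 %/ a2 * 1 <= c1 %/ a2 * a2 by rewrite leq_mul2l a2_gt0 orbT.
  by lia.
(* A weight of at most [h.+1] at [i.+1] would represent [x] once a single [a3] is dropped. *)
case=> // i _ iy; rewrite ltnNge; apply/negP => w; apply: nx.
exists (rem a2 a3 (x + a3) i.+1), (quo a2 a3 (x + a3) i.+1), i.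
have := quo_remE a2 iy; move: w; rewrite /weight mulSn; lia.
Qed.
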